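(* Let $\Lambda=\bigoplus_{i\ge 0}\Lambda_i$ be a locally finite dimensional graded $k$-algebra with $\Lambda_0$ augmented over $k^{\times r}$, and let $T$ be a graded self-orthogonal $\Lambda$-module. There is an isomorphism of graded algebras $$\Big[\bigoplus_{i\geq 0}\operatorname{Ext}^i_\Lambda(T,T)\Big]^{\mathrm{op}}\cong\Big[\bigoplus_{i\geq 0}\operatorname{Ext}^i_{\mathsf{Gr}\,\Lambda}(T,T\langle i\rangle)\Big]^{\mathrm{op}}.$$
   Context: $k$ is a field. $\Lambda=\bigoplus_{i\ge 0}\Lambda_i$ is a graded $k$-algebra with $\dim_k\Lambda_i<\infty$ for all $i\geq 0$ (locally finite dimensional), and $\Lambda_0$ is augmented over $k\times\cdots\times k=k^{\times r}$ for some $r>0$; in particular $\Lambda_0$ is a basic $k$-algebra (with $\Lambda_0/\operatorname{rad}\Lambda_0\cong k^{\times r}$). $\Lambda$ is not assumed noetherian. Modules are left modules. $\mathsf{Gr}\,\Lambda$ is the category of graded $\Lambda$-modules $M=\bigoplus_{i\in\mathbb Z}M_i$ with degree $0$ morphisms; $\operatorname{Ext}_{\mathsf{Gr}\,\Lambda}$ is Ext in this category and $\operatorname{Ext}_\Lambda$ is Ext in the category of ungraded $\Lambda$-modules. The shift is $(M\langle j\rangle)_i=M_{i-j}$. A graded self-orthogonal module is a finitely generated basic (pairwise non-isomorphic indecomposable summands) graded $\Lambda$-module $T$ concentrated in degree $0$ such that $\operatorname{Ext}^i_{\mathsf{Gr}\,\Lambda}(T,T\langle j\rangle)=0$ whenever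 $i\neq j$. Both algebras carry the Yoneda product (on the right-hand side, $\operatorname{Ext}^i_{\mathsf{Gr}\,\Lambda}(T,T\langle i\rangle)\simeq\operatorname{Hom}_{\mathcal D(\mathsf{Gr}\,\Lambda)}(T,T\langle i\rangle[i])$, composed after applying the automorphisms $\langle i\rangle[i]$), with degree $i$ part given by the $i$th summand; $\mathrm{op}$ denotes the opposite algebra. *)

(* Defs.v *)
From HB Require Import structures.
From mathcomp Require Import all_boot all_order all_algebra.
From mathcomp Require Import generic_quotient ring_quotient.
From mathcomp Require Import boolp classical_sets.

Set Implicit Arguments.
Unset Strict Implicit.
Unset Printing Implicit Defensive.

Import GRing.Theory.
Local Open Scope classical_set_scope.
Local Open Scope quotient_scope.
Local Open Scope ring_scope.

(** * Graded algebras and graded modules *)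

(* [V] is the internal direct sum of the subgroups [p i]. *)
Definition is_grading (I : eqType) (V : zmodType) (p : I -> set V) : Prop :=
  [/\ forall i, p i 0,
      forall i x y, p i x -> p i y -> p i (x - y),
      forall x, exists (s : seq I) (c : I -> V),
        (forall i, p i (c i)) /\ x = \sum_(i <- s) c i
    & forall (s : seq I) (c : I -> V), uniq s -> (forall i, p i (c i)) ->
        \sum_(i <- s) c i = 0 -> forall i, i \in s -> c i = 0].

Record grAlgebra (k : fieldType) := GrAlgebra {
  galg_sort :> algType k;
  galg_piece : nat -> set galg_sort;
  galg_grading : is_grading galg_piece;
  galg_pieceZ : forall i (a : k) x, galg_piece i x -> galg_piece i (a *: x);
  galg_piece1 : galg_piece 0%N 1;
  galg_pieceM : forall i j x y,
    galg_piece i x -> galg_piece j y -> galg_piece (i + j)%N (x * y)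
}.

Definition locally_finite (k : fieldType) (L : grAlgebra k) : Prop :=
  forall i, exists s : seq L,
    (forall x, x \in s -> galg_piece i x) /\
    forall x, galg_piece i x ->
      exists c : 'I_(size s) -> k, x = \sum_j c j *: s`_j.

Section DegreeZero.
Variables (k : fieldType) (L : grAlgebra k).
Local Notation L0 := (@galg_piece k L 0%N).

Definition left_ideal0 (I : set L) : Prop :=
  [/\ I `<=` L0, I 0, forall x y, I x -> I y -> I (x + y)
    & forall a x, L0 a -> I x -> I (a * x)].

Definition maximal_left_ideal0 (I : set L) : Prop :=
  [/\ left_ideal0 I, ~ I 1
    & forall J, left_ideal0 J -> ~ J 1 -> I `<=` J -> J `<=` I].

Definition rad0 : set L :=
  [set x | L0 x /\ forall I, maximal_left_ideal0 I -> I x].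

(* [eps] is only meaningful on the degree zero part.  The last condition says
   that the augmentation induces an isomorphism from the degree zero part
   modulo its radical to [k ^ r]. *)
Definition augmented0 (r : nat) : Prop :=
  exists (eta : {ffun 'I_r -> k} -> L) (eps : L -> {ffun 'I_r -> k}),
  [/\ [/\ forall u, L0 (eta u),
          {morph eta : u v / u + v},
          forall a (u : {ffun 'I_r -> k}), eta [ffun s => a * u s] = a *: eta u,
          eta 1 = 1
        & {morph eta : u v / u * v}],
      [/\ forall x y, L0 x -> L0 y -> eps (x + y) = eps x + eps y,
          forall a x, L0 x -> eps (a *: x) = [ffun s => a * eps x s],
          eps 1 = 1
        & forall x y, L0 x -> L0 y -> eps (x * y) = eps x * eps y],
      cancel eta eps
    & forall x, L0 x -> (eps x = 0 <-> rad0 x)].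

End DegreeZero.

Record grModule (k : fieldType) (L : grAlgebra k) := GrModule {
  gmod_sort :> lmodType L;
  gmod_piece : int -> set gmod_sort;
  gmod_grading : is_grading gmod_piece;
  gmod_pieceZ : forall i j (a : L) x,
    galg_piece i a -> gmod_piece j x -> gmod_piece (i%:Z + j) (a *: x)
}.

(** * Spaces of homomorphisms *)

Section ModHom.
Variables (k : fieldType) (L : algType k) (M N : lmodType L).

Definition modHom : Type := {linear M -> N}.

Implicit Types f g h : modHom.

Lemma modHomP f g : (forall x, f x = g x) -> f = g.
Proof.
case: f g => f cf [g cg] /= fg.
have {fg} efg : f = g := funext fg.
subst g; congr GRing.Linear.Pack.
case: cf cg => [[[f0 fD]] [fs]] [[[g0 gD]] [gs]].
by rewrite (Prop_irrelevance f0 g0) (Prop_irrelevance fD gD)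
           (Prop_irrelevance fs gs).
Qed.

HB.instance Definition _ := gen_eqMixin modHom.
HB.instance Definition _ := gen_choiceMixin modHom.

Definition modHom0 : modHom := \0 : M -> N.
Definition modHom_opp f : modHom := \- f.
Definition modHom_add f g : modHom := f \+ g.

Fact modHom_addA : associative modHom_add.
Proof. by move=> f g h; apply: modHomP => x /=; rewrite addrA. Qed.
Fact modHom_addC : commutative modHom_add.
Proof. by move=> f g; apply: modHomP => x /=; rewrite addrC. Qed.
Fact modHom_add0 : left_id modHom0 modHom_add.
Proof. by move=> f; apply: modHomP => x /=; rewrite add0r. Qed.
Fact modHom_addN : left_inverse modHom0 modHom_opp modHom_add.
Proof. by move=> f; apply: modHomP => x /=; rewrite addNr. Qed.
HB.instance Definition _ := GRing.isZmodule.Build modHom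
  modHom_addA modHom_addC modHom_add0 modHom_addN.

(* [k] acts on [N] through [L], i.e., [a] acts as [a%:A]. *)
Fact modHom_scale_linear (a : k) f : linear (fun x => a%:A *: f x).
Proof.
by move=> b x y; rewrite linearP scalerDr !scalerA -scalerAl mul1r
                         -scalerAr mulr1.
Qed.
Definition modHom_scale (a : k) f : modHom :=
  HB.pack (fun x => a%:A *: f x)
    (GRing.isLinear.Build L M N *:%R _ (modHom_scale_linear a f)).

Fact modHom_scaleA a b f :
  modHom_scale a (modHom_scale b f) = modHom_scale (a * b) f.
Proof.
by apply: modHomP => x /=; rewrite scalerA -scalerAl mul1r scalerA.
Qed.
Fact modHom_scale1 : left_id 1 modHom_scale.
Proof. by move=> f; apply: modHomP => x /=; rewrite !scale1r. Qed.
Fact modHom_scaleDr : right_distributive modHom_scale +%R.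
Proof. by move=> a f g; apply: modHomP => x /=; rewrite scalerDr. Qed.
Fact modHom_scaleDl f : {morph modHom_scale^~ f : a b / a + b}.
Proof. by move=> a b; apply: modHomP => x /=; rewrite !scalerDl. Qed.
HB.instance Definition _ := GRing.Zmodule_isLmodule.Build k modHom
  modHom_scaleA modHom_scale1 modHom_scaleDr modHom_scaleDl.

End ModHom.

Section GrHom.
Variables (k : fieldType) (L : grAlgebra k) (M N : grModule L).

(* Degree zero morphisms. *)
Definition graded_hom : {pred modHom M N} :=
  fun f => `[< forall j x, gmod_piece j x -> gmod_piece j (f x) >].

Fact graded_hom_submod : submod_closed graded_hom.
Proof.
have [N0 NB _ _] := gmod_grading N.
have ND j x y : gmod_piece (g := N) j x -> gmod_piece j y ->
    gmod_piece j (x + y).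
  by move=> hx hy; rewrite -[y]opprK -[- y]sub0r; apply: (NB) => //; apply: (NB).
split=> [|a f g /asboolP hf /asboolP hg]; apply/asboolP => j x hx /=.
  exact: N0.
apply: ND; last exact: hg.
have ha : galg_piece (g := L) 0%N a%:A.
  exact/galg_pieceZ/galg_piece1.
by rewrite -[j]add0r; apply: gmod_pieceZ ha (hf _ _ hx).
Qed.
HB.instance Definition _ :=
  GRing.isSubmodClosed.Build k (modHom M N) graded_hom graded_hom_submod.

Record grHom := GrHom {
  grHom_val : modHom M N;
  grHom_valP : grHom_val \in graded_hom
}.
HB.instance Definition _ := [isSub for grHom_val].
HB.instance Definition _ := [Choice of grHom by <:].
HB.instance Definition _ := [SubChoice_isSubLmodule of grHom by <:].
Coercion grHom_linear (f : grHom) : {linear M -> N} := grHom_val f.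

End GrHom.

Section Shift.
Variables (k : fieldType) (L : grAlgebra k) (M : grModule L) (j : int).

Definition shift_piece (i : int) : set M := gmod_piece (i - j).

Fact shift_grading : is_grading shift_piece.
Proof.
have [M0 MB Mspan Mind] := gmod_grading M.
split=> [i|i x y|x|s c su cP sum0 i si].
- exact: M0.
- exact: MB.
- have [s [c [cP ->]]] := Mspan x.
  exists (map (fun i => i + j) s), (fun i => c (i - j)); split=> [i|].
    exact: cP.
  by rewrite big_map; apply: eq_bigr => i _; rewrite addrK.
- have := Mind (map (fun i => i - j) s) (fun i => c (i + j)).
  rewrite map_inj_uniq; last exact: addIr.
  rewrite big_map; under eq_bigr do rewrite subrK.
  have cP' i0 : gmod_piece i0 (c (i0 + j)).
    by have := cP (i0 + j); rewrite /shift_piece addrK.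
  move=> /(_ su cP' sum0 (i - j)); rewrite subrK; apply.
  exact: map_f.
Qed.

Fact shift_pieceZ i i' (a : L) x :
  galg_piece i a -> shift_piece i' x -> shift_piece (i%:Z + i') (a *: x).
Proof. by move=> ha hx; rewrite /shift_piece -addrA; exact: gmod_pieceZ. Qed.

Definition gshift : grModule L := GrModule shift_grading shift_pieceZ.

End Shift.

(** * Cohomology *)

Record cochain (k : fieldType) := Cochain {
  cochain_sort :> nat -> lmodType k;
  codiff : forall i, {linear cochain_sort i -> cochain_sort i.+1}
}.

Section Cohomology.
Variables (k : fieldType) (C : cochain k) (i : nat).

Definition is_cocycle : {pred C i} := fun x => codiff C i x == 0.

Fact is_cocycle_submod : submod_closed is_cocycle.
Proof.
split=> [|a x y /eqP hx /eqP hy]; apply/eqP; first exact: linear0.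
by rewrite linearP hx hy scaler0 addr0.
Qed.
HB.instance Definition _ :=
  GRing.isSubmodClosed.Build k (C i) is_cocycle is_cocycle_submod.

Record cocycle := Cocycle {
  cocycle_val :> C i;
  cocycle_valP : cocycle_val \in is_cocycle
}.
HB.instance Definition _ := [isSub for cocycle_val].
HB.instance Definition _ := [Choice of cocycle by <:].
HB.instance Definition _ := [SubChoice_isSubLmodule of cocycle by <:].

Definition is_coboundary : C i -> Prop :=
  match i with
  | 0 => fun x => x = 0
  | j.+1 => fun x => exists y : C j, codiff C j y = x
  end.

Definition coboundary : {pred cocycle} := fun z => `[< is_coboundary z >].

Fact coboundary_submod : submod_closed coboundary.
Proof.
have B0 : is_coboundary 0.
  rewrite /is_coboundary; case: i => [//|j]; exists 0; exact: linear0.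
have BP a (x y : C i) : is_coboundary x -> is_coboundary y ->
    is_coboundary (a *: x + y).
  move: x y; rewrite /is_coboundary; case: i => [|j] x y.
    by move=> -> ->; rewrite scaler0 addr0.
  by move=> [x' <-] [y' <-]; exists (a *: x' + y'); rewrite linearP.
split=> [|a x y /asboolP hx /asboolP hy]; apply/asboolP; first exact: B0.
exact: BP.
Qed.
HB.instance Definition _ :=
  GRing.isSubmodClosed.Build k cocycle coboundary coboundary_submod.

Definition cohomology : Type := Quotient.quot coboundary.
HB.instance Definition _ := GRing.Zmodule.on cohomology.

Definition coclass (z : cocycle) : cohomology :=
  \pi_(Quotient.quot coboundary) z.

Lemma coclassP (z w : cocycle) :
  coclass z = coclass w <-> is_coboundary (z - w : cocycle).
Proof.
rewrite /coclass; split.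
  by move=> /eqP; rewrite -Quotient.idealrBE => /asboolP.
by move=> h; apply/eqP; rewrite -Quotient.idealrBE; exact/asboolP.
Qed.

Lemma coclass_repr (x : cohomology) : exists z, x = coclass z.
Proof. by exists (repr x); rewrite /coclass reprK. Qed.

Fact coclassD : {morph coclass : z w / z + w}.
Proof. by move=> z w; rewrite /coclass pi_addr. Qed.

Definition cohomology_scale (a : k) (x : cohomology) : cohomology :=
  coclass (a *: (repr x : cocycle)).

Fact coclassZ a (z : cocycle) :
  cohomology_scale a (coclass z) = coclass (a *: z).
Proof.
apply/coclassP; rewrite -scalerBr.
have : is_coboundary (repr (coclass z) - z : cocycle).
  by apply/coclassP; rewrite {1}/coclass reprK.
have [_ BP] := coboundary_submod.
move=> /asboolP h; have /asboolP := BP a _ 0 h (rpred0 _).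
by rewrite addr0.
Qed.

Fact cohomology_scaleA a b x :
  cohomology_scale a (cohomology_scale b x) = cohomology_scale (a * b) x.
Proof. by have [z ->] := coclass_repr x; rewrite !coclassZ scalerA. Qed.
Fact cohomology_scale1 : left_id 1 cohomology_scale.
Proof.
by move=> x; have [z ->] := coclass_repr x; rewrite coclassZ scale1r.
Qed.
Fact cohomology_scaleDr : right_distributive cohomology_scale +%R.
Proof.
move=> a x y; have [z ->] := coclass_repr x; have [w ->] := coclass_repr y.
by rewrite -coclassD !coclassZ scalerDr coclassD.
Qed.
Fact cohomology_scaleDl x : {morph cohomology_scale^~ x : a b / a + b}.
Proof.
move=> a b; have [z ->] := coclass_repr x.
by rewrite !coclassZ scalerDl coclassD.
Qed.
HB.instance Definition _ := GRing.Zmodule_isLmodule.Build k cohomology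
  cohomology_scaleA cohomology_scale1 cohomology_scaleDr cohomology_scaleDl.

End Cohomology.

(** * Graded algebras such as Ext-algebras, given by their components *)

(* Only the data that isomorphisms have to respect; [gpiece A i] is the
   component of degree [i]. *)
Record galgData (k : fieldType) := GalgData {
  gpiece :> nat -> lmodType k;
  gone : gpiece 0%N;
  gmul : forall i j, gpiece i -> gpiece j -> gpiece (i + j)%N
}.

Definition galg_op (k : fieldType) (A : galgData k) : galgData k :=
  {| gpiece := A;
     gone := gone A;
     gmul := fun i j x y => ecast n (A n) (addnC j i) (gmul y x) |}.

Definition galg_iso (k : fieldType) (A B : galgData k) : Prop :=
  exists phi : forall i, {linear A i -> B i},
  [/\ forall i, bijective (phi i),
      phi 0%N (gone A) = gone B
    & forall i j (x : A i) (y : A j),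
        phi (i + j)%N (gmul x y) = gmul (phi i x) (phi j y)].

(** * Ext of ungraded modules *)

Section Ext.
Variables (k : fieldType) (L : algType k).
Implicit Types (M N T : lmodType L).

Definition projective (P : lmodType L) : Prop :=
  forall (M N : lmodType L) (e : modHom M N) (f : modHom P N),
    (forall y, exists x, e x = y) ->
    exists g : modHom P M, forall x, e (g x) = f x.

Record resolution (T : lmodType L) := Resolution {
  res_obj :> nat -> lmodType L;
  res_d : forall n, modHom (res_obj n.+1) (res_obj n);
  res_aug : modHom (res_obj 0%N) T;
  res_proj : forall n, projective (res_obj n);
  res_surj : forall y, exists x, res_aug x = y;
  res_exact0 : forall x, res_aug x = 0 <-> exists y, res_d 0%N y = x;
  res_exact : forall n x, res_d n x = 0 <-> exists y, res_d n.+1 y = x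
}.

Section Precomp.
Variables (M' M N : lmodType L) (d : modHom M' M).

Definition precomp (f : modHom M N) : modHom M' N :=
  (f : {linear M -> N}) \o (d : {linear M' -> M}) : {linear M' -> N}.

Fact precomp_linear : linear precomp.
Proof. by move=> a f g; apply: modHomP. Qed.
HB.instance Definition _ := GRing.isLinear.Build k (modHom M N) (modHom M' N)
  _ precomp precomp_linear.
End Precomp.

Section ExtGroups.
Variables (T : lmodType L) (P : resolution T).

Definition Hom_complex (N : lmodType L) : cochain k :=
  @Cochain k (fun i => modHom (P i) N) (fun i => @precomp _ _ N (res_d P i)).

Definition Ext (N : lmodType L) (i : nat) : lmodType k :=
  cohomology (Hom_complex N) i.

Definition cocycle_hom N i (z : cocycle (Hom_complex N) i) : modHom (P i) N :=
  cocycle_val z.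

(* [F] is a morphism of complexes of degree [-i] lifting the cocycle [f]. *)
Definition is_lift (i : nat) (f : modHom (P i) T)
    (F : forall n, modHom (P (n + i)%N) (P n)) : Prop :=
  (forall x, res_aug P (F 0%N x) = f x) /\
  (forall n x, res_d P n (F n.+1 x) = F n (res_d P (n + i)%N x)).

(* The Yoneda product of the class of [g] with the class of [f] is the class
   of [g \o F j], where [F] lifts [f]; by the comparison theorem such a lift
   exists, and the class does not depend on the choices. *)
Definition yoneda (j i : nat) (x : Ext T j) (y : Ext T i) : Ext T (j + i)%N :=
  xget 0 [set z | exists (g : cocycle (Hom_complex T) j)
                         (f : cocycle (Hom_complex T) i)
                         (F : forall n, modHom (P (n + i)%N) (P n))
                         (h : cocycle (Hom_complex T) (j + i)%N),
    [/\ x = coclass g, y = coclass f, is_lift (cocycle_hom f) F,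
        forall u, cocycle_hom h u = cocycle_hom g (F j u)
      & z = coclass h]].

Fact res_aug_cocycle : (res_aug P : Hom_complex T 0%N) \in @is_cocycle _ (Hom_complex T) 0%N.
Proof.
apply/eqP/modHomP => x /=; apply/res_exact0; by exists x.
Qed.

Definition ExtAlg : galgData k :=
  {| gpiece := Ext T;
     gone := coclass (Cocycle res_aug_cocycle);
     gmul := yoneda |}.

End ExtGroups.
End Ext.

(** * Ext of graded modules *)

Section GrExt.
Variables (k : fieldType) (L : grAlgebra k).

Definition gr_projective (P : grModule L) : Prop :=
  forall (M N : grModule L) (e : grHom M N) (f : grHom P N),
    (forall y, exists x, e x = y) ->
    exists g : grHom P M, forall x, e (g x) = f x.

Record gr_resolution (T : grModule L) := GrResolution {
  gres_obj :> nat -> grModule L;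
  gres_d : forall n, grHom (gres_obj n.+1) (gres_obj n);
  gres_aug : grHom (gres_obj 0%N) T;
  gres_proj : forall n, gr_projective (gres_obj n);
  gres_surj : forall y, exists x, gres_aug x = y;
  gres_exact0 : forall x, gres_aug x = 0 <-> exists y, gres_d 0%N y = x;
  gres_exact : forall n x, gres_d n x = 0 <-> exists y, gres_d n.+1 y = x
}.

Section GrPrecomp.
Variables (M' M N : grModule L) (d : grHom M' M).

Fact gr_precomp_graded (f : grHom M N) :
  precomp (N := N) d f \in @graded_hom k L M' N.
Proof.
case: f d => f /= /asboolP hf [d' /= /asboolP hd].
by apply/asboolP => j x /hd/hf.
Qed.

Definition gr_precomp (f : grHom M N) : grHom M' N :=
  GrHom (gr_precomp_graded f).

Fact gr_precomp_linear : linear gr_precomp.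
Proof. by move=> a f g; apply/val_inj/modHomP. Qed.
HB.instance Definition _ := GRing.isLinear.Build k (grHom M N) (grHom M' N)
  _ gr_precomp gr_precomp_linear.
End GrPrecomp.

Section GrExtGroups.
Variables (T : grModule L) (P : gr_resolution T).

Definition grHom_complex (N : grModule L) : cochain k :=
  @Cochain k (fun i => grHom (P i) N) (fun i => @gr_precomp _ _ N (gres_d P i)).

Definition grExt (N : grModule L) (i : nat) : lmodType k :=
  cohomology (grHom_complex N) i.

Definition gr_cocycle_hom N i (z : cocycle (grHom_complex N) i) :
  grHom (P i) N := cocycle_val z.

(* The product of [g : T -> T<j>[j]] with [f : T -> T<i>[i]] is
   [g<i>[i] \o f]; shifting does not change the underlying functions, so that
   [g<i>] is again [g]. *)
Definition is_gr_lift (i : nat) (f : grHom (P i) (gshift T i%:Z))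
    (F : forall n, grHom (P (n + i)%N) (gshift (P n) i%:Z)) : Prop :=
  (forall x, gres_aug P (F 0%N x) = f x) /\
  (forall n x, gres_d P n (F n.+1 x) = F n (gres_d P (n + i)%N x)).

Definition gr_yoneda (j i : nat) (x : grExt (gshift T j%:Z) j)
    (y : grExt (gshift T i%:Z) i) :
    grExt (gshift T (j + i)%N%:Z) (j + i)%N :=
  xget 0 [set z | exists (g : cocycle (grHom_complex (gshift T j%:Z)) j)
                         (f : cocycle (grHom_complex (gshift T i%:Z)) i)
                         (F : forall n, grHom (P (n + i)%N)
                                              (gshift (P n) i%:Z))
                         (h : cocycle (grHom_complex (gshift T (j + i)%N%:Z))
                                      (j + i)%N),
    [/\ x = coclass g, y = coclass f, is_gr_lift (gr_cocycle_hom f) F,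
        forall u, gr_cocycle_hom h u = gr_cocycle_hom g (F j u)
      & z = coclass h]].

Fact gr_unit_graded :
  (gres_aug P : modHom (P 0%N) (gshift T 0)) \in
    @graded_hom k L (P 0%N) (gshift T 0).
Proof.
case: (gres_aug P) => e /= /asboolP he; apply/asboolP => j x /he.
by rewrite /gmod_piece/= /shift_piece subr0.
Qed.

Fact gr_unit_cocycle :
  (GrHom gr_unit_graded : grHom_complex (gshift T 0%N%:Z) 0%N) \in
    @is_cocycle _ (grHom_complex (gshift T 0%N%:Z)) 0%N.
Proof.
by apply/eqP/val_inj/modHomP => x /=; apply/gres_exact0; exists x.
Qed.

Definition grExtAlg : galgData k :=
  {| gpiece := fun i => grExt (gshift T i%:Z) i;
     gone := coclass (Cocycle gr_unit_cocycle);
     gmul := gr_yoneda |}.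

End GrExtGroups.

(** * Graded self-orthogonal modules *)

Definition finitely_generated (M : lmodType L) : Prop :=
  exists s : seq M, forall x, exists c : 'I_(size s) -> L,
    x = \sum_i c i *: s`_i.

Definition concentrated_in_degree0 (M : grModule L) : Prop :=
  forall j (x : M), j != 0 -> gmod_piece j x -> x = 0.

Definition gr_isomorphic (M N : grModule L) : Prop :=
  exists (f : grHom M N) (g : grHom N M), cancel f g /\ cancel g f.

(* Bijectivity of the map from the sum of the [S i] to [M] with
   components [u i]. *)
Definition is_direct_sum (I : finType) (S : I -> grModule L) (M : grModule L)
    (u : forall i, grHom (S i) M) : Prop :=
  forall x : M, exists! s : (forall i, S i), x = \sum_i u i (s i).

Definition indecomposable (M : grModule L) : Prop :=
  (exists x : M, x != 0) /\
  forall (S : bool -> grModule L) (u : forall b, grHom (S b) M),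
    is_direct_sum u -> exists b, forall x : S b, x = 0.

Definition basic (M : grModule L) : Prop :=
  exists (n : nat) (S : 'I_n -> grModule L) (u : forall i, grHom (S i) M),
  [/\ is_direct_sum u,
      forall i, indecomposable (S i)
    & forall i j, gr_isomorphic (S i) (S j) -> i = j].

(* The vanishing condition does not depend on the projective resolution. *)
Definition graded_self_orthogonal (T : grModule L) : Prop :=
  [/\ finitely_generated T, basic T, concentrated_in_degree0 T
    & forall (Q : gr_resolution T) (i : nat) (j : int), i%:Z != j ->
        forall x : grExt Q (gshift T j) i, x = 0].

End GrExt.

(* Main.v *)
(* Since [T] lives in degree zero, elements of positive degree of [L] kill it;
   so for a graded module [M] a homomorphism [M -> T] is the same thing as an
   arbitrary family of degree zero homomorphisms [M -> T<j>], one for each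
   integer [j], even when [M] is not finitely generated. A graded projective
   resolution is also an ungraded one, because the forgetful functor has an
   exact right adjoint, so [Ext^i(T, T)] is the product over [j] of the graded
   [Ext^i(T, T<j>)], and self-orthogonality leaves only the factor [j = i].
   Taking homogeneous components turns ungraded coboundaries and ungraded
   lifts into graded ones, which gives injectivity and multiplicativity. *)
Require Import Defs.
From HB Require Import structures.
From mathcomp Require Import all_boot all_order all_algebra.
From mathcomp Require Import generic_quotient boolp classical_sets functions.

Set Implicit Arguments.
Unset Strict Implicit.
Unset Printing Implicit Defensive.
Import GRing.Theory.
Local Open Scope classical_set_scope.
Local Open Scope ring_scope.

(** * Graded abelian groups *)

(** Both sides reduce to the sum over the indices where [F] is nonzero, and the two filtered lists
    are permutations of each other. This lets decompositions with different index lists be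
    compared. *)
Lemma big_uniq_support (I : eqType) (W : zmodType) (F : I -> W) (s t : seq I) :
  uniq s -> uniq t -> (forall i, i \notin s -> F i = 0) ->
  (forall i, i \notin t -> F i = 0) -> \sum_(i <- s) F i = \sum_(i <- t) F i.
Proof.
move=> us ut Fs Ft.
have nz r : \sum_(i <- r) F i = \sum_(i <- [seq i <- r | F i != 0]) F i.
  rewrite big_filter [LHS](bigID (fun i => F i != 0)) /=.
  by rewrite [X in _ + X]big1 ?addr0 // => i /negPn/eqP.
rewrite nz [RHS]nz; apply: perm_big; apply: uniq_perm; rewrite ?filter_uniq //.
move=> i; rewrite !mem_filter; case: (eqVneq (F i) 0) => //= Fi0.
apply/idP/idP => [_|_]; apply/negPn/negP => h.
  by rewrite Ft ?eqxx in Fi0.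
by rewrite Fs ?eqxx in Fi0.
Qed.

Section Grading.
Variables (I : eqType) (V : zmodType) (p : I -> set V).
Hypothesis gr : is_grading p.

Lemma piece0 i : p i 0. Proof. by case: gr. Qed.

Lemma pieceB i x y : p i x -> p i y -> p i (x - y).
Proof. by case: gr => _ + _ _; apply. Qed.

Lemma pieceN i x : p i x -> p i (- x).
Proof. by rewrite -[- x]sub0r; apply: pieceB; exact: piece0. Qed.

Lemma pieceD i x y : p i x -> p i y -> p i (x + y).
Proof. by move=> px py; rewrite -[y]opprK; apply/pieceB/pieceN. Qed.

Lemma pieceMn i x n : p i x -> p i (x *+ n).
Proof.
by move=> px; elim: n => [|n IHn]; [exact: piece0 | rewrite mulrS; exact: pieceD].
Qed.

(** The list [s] may contain indices whose term is zero, so [x] determines only the family [c]. *)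
Definition decomposition (x : V) (c : I -> V) (s : seq I) : Prop :=
  [/\ uniq s, forall i, p i (c i), forall i, i \notin s -> c i = 0
    & x = \sum_(i <- s) c i].

Lemma decomposition_exists x : exists cs, decomposition x cs.1 cs.2.
Proof.
have [_ _ /(_ x) [s [c [pc ->]]] _] := gr.
(* The spanning clause of [is_grading] allows repeated indices, so [c i] is counted as often as [i]
   occurs in [s]. *)
exists (fun i => c i *+ count_mem i s, undup s); split=> /=.
- exact: undup_uniq.
- by move=> i; exact: pieceMn.
- by move=> i; rewrite mem_undup => /count_memPn ->.
- rewrite -big_undup_iterop_count.
  exact: eq_bigr.
Qed.

Lemma decomposition_unique x c s c' s' :
  decomposition x c s -> decomposition x c' s' -> c =1 c'.
Proof.
move=> [us pc cs xE] [us' pc' cs' xE'] i; apply/eqP; rewrite -subr_eq0; apply/eqP.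
have ut := undup_uniq (s ++ s').
have notin j : j \notin undup (s ++ s') -> c j = 0 /\ c' j = 0.
  by rewrite mem_undup mem_cat negb_or => /andP[/cs-> /cs'->].
have [si|/notin[-> ->]] := boolP (i \in undup (s ++ s')); last by rewrite subrr.
have [_ _ _ indep] := gr.
apply: (indep _ (fun j => c j - c' j) ut) => // [j|]; first exact: pieceB.
rewrite sumrB (@big_uniq_support _ _ c _ s) // -?xE => [|j /notin[]//].
by rewrite (@big_uniq_support _ _ c' _ s') // -?xE' ?subrr => [|j /notin[]//].
Qed.

Definition component (i : I) (x : V) : V :=
  (projT1 (cid (decomposition_exists x))).1 i.

Definition support_seq (x : V) : seq I :=
  (projT1 (cid (decomposition_exists x))).2.

Lemma componentP x : decomposition x (component^~ x) (support_seq x).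
Proof. exact: projT2 (cid (decomposition_exists x)). Qed.

Lemma component_piece i x : p i (component i x).
Proof. by case: (componentP x). Qed.

Lemma component_eq x c s i : decomposition x c s -> component i x = c i.
Proof. by move=> /(decomposition_unique (componentP x))/(_ i). Qed.

Lemma component_homog i x j : p i x -> component j x = if j == i then x else 0.
Proof.
move=> px; apply: (@component_eq x (fun j => if j == i then x else 0) [:: i]).
split=> // [k|k|].
- by case: eqP => [->|_]; [|exact: piece0].
- by rewrite inE => /negPf->.
- by rewrite big_seq1 eqxx.
Qed.

Lemma component_id i x : p i x -> component i x = x.
Proof. by move=> px; rewrite (component_homog _ px) eqxx. Qed.

Lemma componentD i x y : component i (x + y) = component i x + component i y.
Proof.
have [us pc cs xE] := componentP x; have [us' pc' cs' yE] := componentP y.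
pose t := undup (support_seq x ++ support_seq y).
have ut : uniq t by exact: undup_uniq.
have notin j : j \notin t -> component j x = 0 /\ component j y = 0.
  by rewrite mem_undup mem_cat negb_or => /andP[/cs-> /cs'->].
apply: (@component_eq _ (fun i => component i x + component i y) t).
split=> // [j|j /notin[-> ->]|]; [exact: pieceD | exact: addr0 |].
rewrite big_split -(big_uniq_support us ut cs) => [|j /notin[]//].
by rewrite -(big_uniq_support us' ut cs') => [|j /notin[]//]; rewrite -xE -yE.
Qed.

Lemma component0 i : component i 0 = 0.
Proof. by apply: (addIr (component i 0)); rewrite -componentD !add0r. Qed.

Lemma homog_ind (P : V -> Prop) :
  P 0 -> (forall x y, P x -> P y -> P (x + y)) ->
  (forall i x, p i x -> P x) -> forall x, P x.
Proof.
move=> P0 PD Ph x; have [_ pc _ ->] := componentP x.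
elim/big_rec: _ => // i y _; apply: PD; exact: Ph (pc i).
Qed.

(** * Additive maps assembled from one map per degree *)

Section Glue.
Variables (W : zmodType) (phi : I -> V -> W).
Hypothesis phiD : forall i, {morph phi i : x y / x + y}.

Definition glue (x : V) : W := \sum_(i <- support_seq x) phi i (component i x).

Let phi0 i : phi i 0 = 0.
Proof. by apply: (addIr (phi i 0)); rewrite -phiD !add0r. Qed.

Lemma glueE x s : uniq s -> (forall i, i \notin s -> component i x = 0) ->
  glue x = \sum_(i <- s) phi i (component i x).
Proof.
move=> us cs; have [us' _ cs' _] := componentP x.
apply: big_uniq_support => // i /[dup] => [/cs'|/cs] -> _; exact: phi0.
Qed.

Lemma glueD : {morph glue : x y / x + y}.
Proof.
move=> x y; have [_ _ cs _] := componentP x; have [_ _ cs' _] := componentP y.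
have ut := undup_uniq (support_seq x ++ support_seq y).
have notin j : j \notin undup (support_seq x ++ support_seq y) ->
    component j x = 0 /\ component j y = 0.
  by rewrite mem_undup mem_cat negb_or => /andP[/cs-> /cs'->].
rewrite !(glueE ut) => [|i /notin[]//|i /notin[]//|i /notin[cx cy]].
  by rewrite -big_split; apply: eq_bigr => i _ /=; rewrite componentD phiD.
by rewrite componentD cx cy addr0.
Qed.

Lemma glue_homog i x : p i x -> glue x = phi i x.
Proof.
move=> px; rewrite (@glueE _ [:: i]) ?big_seq1 ?component_id // => j.
by rewrite inE (component_homog _ px) => /negPf->.
Qed.

End Glue.

Lemma component_finite x :
  exists s : seq I, forall i, i \notin s -> component i x = 0.
Proof. by exists (support_seq x); case: (componentP x). Qed.

End Grading.

(** * Homogeneous components of homomorphisms *)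

Lemma modHom_exists (k : fieldType) (L : algType k) (M N : lmodType L)
    (f : M -> N) :
  {morph f : x y / x + y} -> (forall a x, f (a *: x) = a *: f x) ->
  exists g : modHom M N, forall x, g x = f x.
Proof.
move=> fD fZ; have lf : linear f by move=> a x y; rewrite fD fZ.
pose g : {linear M -> N} := HB.pack f (GRing.isLinear.Build L M N *:%R f lf).
by exists g.
Qed.

Lemma modHom_on_homog (k : fieldType) (L : grAlgebra k) (M : grModule L)
    (N : lmodType L) (f g : modHom M N) :
  (forall j x, gmod_piece j x -> f x = g x) -> f = g.
Proof.
move=> fg; apply: modHomP; apply: (homog_ind (gmod_grading M)) => //.
  by rewrite !linear0.
by move=> x y fx fy; rewrite !linearD fx fy.
Qed.

(** Only compatibility with homogeneous scalars on homogeneous vectors is assumed. Additivity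
    extends it to all scalars and vectors, by induction first on the scalar and then on the
    vector. *)
Lemma glue_modHom (k : fieldType) (L : grAlgebra k) (M : grModule L)
    (N : lmodType L) (phi : int -> M -> N) :
  (forall j, {morph phi j : x y / x + y}) ->
  (forall i j a x, galg_piece i a -> gmod_piece j x ->
     phi (i%:Z + j) (a *: x) = a *: phi j x) ->
  exists f : modHom M N, forall j x, gmod_piece j x -> f x = phi j x.
Proof.
move=> phiD phiZ; have grM := gmod_grading M; have grL := galg_grading L.
have gD : {morph glue grM phi : x y / x + y} by exact: glueD.
have g0 : glue grM phi 0 = 0.
  by apply: (addIr (glue grM phi 0)); rewrite -gD !add0r.
have [] := @modHom_exists _ _ _ _ (glue grM phi) gD; last first.
  by move=> f fE; exists f => j x xj; rewrite fE (glue_homog grM phiD xj).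
apply: (homog_ind grL) => [x|a b ha hb x|i a ai].
- by rewrite !scale0r.
- by rewrite !scalerDl gD ha hb.
apply: (homog_ind grM) => [|x y hx hy|j x xj]; first by rewrite scaler0 g0 scaler0.
  by rewrite scalerDr !gD hx hy scalerDr.
rewrite (glue_homog grM phiD xj) (glue_homog grM phiD (gmod_pieceZ ai xj)).
exact: phiZ.
Qed.

Lemma grHom_piece (k : fieldType) (L : grAlgebra k) (M N : grModule L)
  (f : grHom M N) j x : gmod_piece j x -> gmod_piece j (f x).
Proof. by case: f => f /= /asboolP; apply. Qed.

Lemma grHom_exists (k : fieldType) (L : grAlgebra k) (M N : grModule L)
    (f : modHom M N) :
  (forall j x, gmod_piece j x -> gmod_piece j (f x)) ->
  exists g : grHom M N, forall x, g x = f x.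
Proof.
move=> fg; have fP : f \in @graded_hom k L M N by exact/asboolP.
by exists (GrHom fP).
Qed.

Lemma component_scale (k : fieldType) (L : grAlgebra k) (M : grModule L) i j
    (a : L) (x : M) : galg_piece i a ->
  component (gmod_grading M) (i%:Z + j) (a *: x)
    = a *: component (gmod_grading M) j x.
Proof.
move=> ai; have grM := gmod_grading M.
move: x; apply: (homog_ind grM) => [|x y hx hy|l x xl].
- by rewrite scaler0 !component0 scaler0.
- by rewrite scalerDr !componentD hx hy scalerDr.
rewrite (component_homog _ _ xl) (component_homog _ _ (gmod_pieceZ ai xl)).
by rewrite (inj_eq (addrI _)); case: eqP => // _; rewrite scaler0.
Qed.

Lemma component_grHom (k : fieldType) (L : grAlgebra k) (M N : grModule L)
    (f : grHom M N) j x :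
  component (gmod_grading N) j (f x) = f (component (gmod_grading M) j x).
Proof.
have grM := gmod_grading M.
move: x; apply: (homog_ind grM) => [|x y hx hy|l x xl].
- by rewrite linear0 !component0 linear0.
- by rewrite linearD !componentD hx hy linearD.
rewrite (component_homog _ _ xl) (component_homog _ _ (grHom_piece f xl)).
by case: eqP => // _; rewrite linear0.
Qed.

(** The index [j - t] follows the convention that the piece of degree [j] of [gshift N t] is the
    piece of degree [j - t] of [N]. *)
Lemma homog_component_exists (k : fieldType) (L : grAlgebra k)
    (M N : grModule L) (f : modHom M N) (t : int) :
  exists g : grHom M (gshift N t), forall j x, gmod_piece j x ->
    g x = component (gmod_grading N) (j - t) (f x).
Proof.
have [||g gE] := @glue_modHom _ _ M N
  (fun j x => component (gmod_grading N) (j - t) (f x)).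
- by move=> j x y; rewrite linearD componentD.
- by move=> i j a x ai xj; rewrite linearZ -addrA component_scale.
have [|g' g'E] := @grHom_exists _ _ M (gshift N t) g.
  by move=> j x xj; rewrite (gE _ _ xj); exact: component_piece.
by exists g' => j x xj; rewrite g'E (gE _ _ xj).
Qed.

Definition homog_component (k : fieldType) (L : grAlgebra k)
    (M N : grModule L) (f : modHom M N) (t : int) : grHom M (gshift N t) :=
  projT1 (cid (homog_component_exists f t)).

Lemma homog_componentE (k : fieldType) (L : grAlgebra k) (M N : grModule L)
    (f : modHom M N) (t j : int) (x : M) : gmod_piece j x ->
  homog_component f t x = component (gmod_grading N) (j - t) (f x).
Proof. exact: (projT2 (cid (homog_component_exists f t))). Qed.

(* Elements of positive degree act by zero on [T]; hence the family [u] glues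
   to a homomorphism although its members have different degrees. *)
Lemma glue_grHoms (k : fieldType) (L : grAlgebra k) (M T : grModule L)
    (u : forall j : int, grHom M (gshift T j)) :
  concentrated_in_degree0 T ->
  exists f : modHom M T, forall j x, gmod_piece j x -> f x = u j x.
Proof.
move=> T0; apply: glue_modHom => [j x y|i j a x ai xj]; first exact: linearD.
have [->|i0] := eqVneq i 0%N; first by rewrite add0r linearZ.
rewrite linearZ.
have h l (y : T) : gmod_piece l y -> a *: y = 0.
  move=> yl; have [l0|l0] := eqVneq l 0; last by rewrite (T0 _ _ l0 yl) scaler0.
  by apply: T0 (gmod_pieceZ ai yl); rewrite l0 addr0.
have ul j' : gmod_piece (g := T) (j - j') (u j' x).
  exact: (grHom_piece (u j') xj).
by transitivity (0 : T); [|symmetry]; exact: h (ul _).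
Qed.

(** * Graded projective modules are projective *)

Section Cofree.
Variables (k : fieldType) (L : grAlgebra k).

(* The right adjoint of the forgetful functor to ungraded modules sends [N]
   to the graded module with all components equal to [N]. *)
Section Object.
Variable N : lmodType L.

Definition finite_support : {pred int -> N} :=
  fun u => `[< exists s : seq int, forall j, j \notin s -> u j = 0 >].

Fact finite_support_zmod : zmod_closed finite_support.
Proof.
split=> [|u v /asboolP[s us] /asboolP[t vt]]; apply/asboolP; first by exists [::].
exists (s ++ t) => j; rewrite mem_cat negb_or => /andP[/us uj /vt vj].
by rewrite !fctE uj vj subrr.
Qed.
HB.instance Definition _ :=
  GRing.isZmodClosed.Build (int -> N : Type) finite_support finite_support_zmod.

Record cofree := Cofree {
  cofree_val :> int -> N;
  cofree_valP : cofree_val \in finite_support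
}.
HB.instance Definition _ := [isSub for cofree_val].
HB.instance Definition _ := [Choice of cofree by <:].
HB.instance Definition _ := [SubChoice_isSubZmodule of cofree by <:].

Lemma cofreeP (u v : cofree) : (forall j, u j = v j) -> u = v.
Proof. by move=> uv; apply/val_inj/funext. Qed.

Lemma cofreeD (u v : cofree) j : (u + v) j = u j + v j.
Proof. by []. Qed.

Lemma cofree_exists (u : int -> N) (s : seq int) :
  (forall j, j \notin s -> u j = 0) -> exists v : cofree, forall j, v j = u j.
Proof.
move=> us; have uP : u \in finite_support by apply/asboolP; exists s.
by exists (Cofree uP).
Qed.

Lemma cofree_finite (u : cofree) :
  exists s : seq int, forall j, j \notin s -> u j = 0.
Proof. by case: u => u /= /asboolP. Qed.

(** This is the contribution of the degree [i] part of a scalar to entry [j]; [glue] adds these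
    contributions over all [i]. *)
Definition shift_act (u : cofree) (j : int) (i : nat) (a : L) : N :=
  a *: u (j - i%:Z).

Fact shift_actD u j i : {morph shift_act u j i : a b / a + b}.
Proof. by move=> a b; rewrite /shift_act scalerDl. Qed.

Fact cofree_scale_exists (a : L) (u : cofree) :
  exists v : cofree, forall j, v j = glue (galg_grading L) (shift_act u j) a.
Proof.
have [s us] := cofree_finite u; have [t at0] := component_finite (galg_grading L) a.
(* A nonzero entry of the product can only sit at a sum of an index in the support of [u] and a
   degree occurring in [a]. *)
apply: (@cofree_exists _ [seq j + i%:Z | j <- s, i <- undup t]) => j jst.
rewrite (glueE (shift_actD u j) (undup_uniq t)) => [|i].
  rewrite big_seq big1 // => i it; rewrite /shift_act us ?scaler0 //.
  apply: contra jst => js.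
  by apply/allpairsP; exists (j - i%:Z, i); rewrite /= subrK; split.
by rewrite mem_undup => /at0.
Qed.

Definition cofree_scale (a : L) (u : cofree) : cofree :=
  projT1 (cid (cofree_scale_exists a u)).

Lemma cofree_scale_homog i a u j : galg_piece i a ->
  cofree_scale a u j = a *: u (j - i%:Z).
Proof.
move=> ai; rewrite (projT2 (cid (cofree_scale_exists a u))).
exact: (glue_homog (galg_grading L) (shift_actD u j) ai).
Qed.

Fact cofree_scaleDl u : {morph cofree_scale^~ u : a b / a + b}.
Proof.
move=> a b; apply: cofreeP => j; rewrite cofreeD.
by rewrite !(projT2 (cid (cofree_scale_exists _ u))) (glueD _ (shift_actD u j)).
Qed.

Fact cofree_scale0 u : cofree_scale 0 u = 0.
Proof. by apply: (addIr (cofree_scale 0 u)); rewrite -cofree_scaleDl !add0r. Qed.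

Fact cofree_scaleDr : right_distributive cofree_scale +%R.
Proof.
move=> a u v; move: a; apply: (homog_ind (galg_grading L)) => [|a b ha hb|i a ai].
- by rewrite !cofree_scale0 addr0.
- by rewrite !cofree_scaleDl ha hb addrACA.
apply: cofreeP => j; rewrite cofreeD !(cofree_scale_homog _ _ ai).
by rewrite cofreeD scalerDr.
Qed.

Fact cofree_scaler0 a : cofree_scale a 0 = 0.
Proof. by apply: (addIr (cofree_scale a 0)); rewrite -cofree_scaleDr !add0r. Qed.

Fact cofree_scaleA a b u :
  cofree_scale a (cofree_scale b u) = cofree_scale (a * b) u.
Proof.
move: a b; apply: (homog_ind (galg_grading L)) => [b|a a' ha ha' b|i a ai].
- by rewrite mul0r !cofree_scale0.
- by rewrite mulrDl !cofree_scaleDl ha ha'.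
apply: (homog_ind (galg_grading L)) => [|b b' hb hb'|i' b bi].
- by rewrite mulr0 !cofree_scale0 cofree_scaler0.
- by rewrite mulrDr !cofree_scaleDl cofree_scaleDr hb hb'.
apply: cofreeP => j; rewrite (cofree_scale_homog _ _ ai) (cofree_scale_homog _ _ bi).
by rewrite (cofree_scale_homog _ _ (galg_pieceM ai bi)) scalerA PoszD opprD addrA.
Qed.

Fact cofree_scale1 : left_id 1 cofree_scale.
Proof.
move=> u; apply: cofreeP => j.
by rewrite (cofree_scale_homog _ _ (galg_piece1 L)) scale1r subr0.
Qed.

HB.instance Definition _ := GRing.Zmodule_isLmodule.Build L cofree
  cofree_scaleA cofree_scale1 cofree_scaleDr cofree_scaleDl.

Definition cofree_piece (j : int) : set cofree :=
  [set u | forall i, i != j -> u i = 0].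

Fact cofree_grading : is_grading cofree_piece.
Proof.
have sumE s (c : int -> cofree) j : (\sum_(i <- s) c i) j = \sum_(i <- s) c i j.
  by elim/big_rec2: _ => // i _ v _ <-.
have single (u : cofree) j :
    exists v : cofree, forall i, v i = if i == j then u j else 0.
  by apply: (@cofree_exists _ [:: j]) => i; rewrite inE => /negPf->.
split=> [//|j u v uj vj i ij|u|s c us cj /(congr1 cofree_val) sum0 j js].
- by transitivity (u i - v i); rewrite // uj // vj // subrr.
- have [s us] := cofree_finite u; have [c cE] := choice (single u).
  exists (undup s), c; split=> [j i /negPf ij|]; first by rewrite cE ij.
  apply: cofreeP => j; rewrite sumE.
  have [js|js] := boolP (j \in undup s).
    rewrite (bigD1_seq j) ?undup_uniq //= cE eqxx big1 ?addr0 // => i ij.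
    by rewrite cE eq_sym (negPf ij).
  rewrite us -?(mem_undup s) // big_seq big1 // => i si.
  by rewrite cE; case: eqP => // ij; rewrite ij si in js.
apply: cofreeP => i; have [->|/(cj j)//] := eqVneq i j.
have := congr1 (fun f => f j) sum0; rewrite /= sumE (bigD1_seq j) //=.
by rewrite big1 ?addr0 // => i' ij'; apply: cj; rewrite eq_sym.
Qed.

Fact cofree_pieceZ i j (a : L) u :
  galg_piece i a -> cofree_piece j u -> cofree_piece (i%:Z + j) (a *: u).
Proof.
move=> ai uj l lij; rewrite [LHS](cofree_scale_homog _ _ ai) uj ?scaler0 //.
by apply: contra lij => /eqP <-; rewrite addrC subrK.
Qed.

Definition cofree_grModule : grModule L := GrModule cofree_grading cofree_pieceZ.

Lemma cofree_pieceP j (u : cofree_grModule) :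
  gmod_piece j u <-> forall i, i != j -> cofree_val u i = 0.
Proof. by []. Qed.

(** The counit of the adjunction, which adds up the finitely many entries. *)
Lemma cofree_counit_exists : exists f : modHom cofree_grModule N,
  forall j (u : cofree_grModule), gmod_piece j u -> f u = cofree_val u j.
Proof.
apply: glue_modHom => [j u v|i j a u ai uj]; first exact: cofreeD.
by rewrite [LHS](cofree_scale_homog _ _ ai) addrC addKr.
Qed.

End Object.

Lemma cofree_map_exists (M N : lmodType L) (e : modHom M N) :
  exists f : grHom (cofree_grModule M) (cofree_grModule N),
    forall (u : cofree_grModule M) j, cofree_val (f u) j = e (cofree_val u j).
Proof.
have ex (u : cofree M) : exists v : cofree N, forall j, v j = e (u j).
  have [s us] := cofree_finite u; apply: (@cofree_exists _ _ s) => j /us ->.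
  exact: linear0.
have [f fE] := choice ex.
have [u v|a u|f' f'E] :=
  @modHom_exists _ _ (cofree_grModule M) (cofree_grModule N) f.
- by apply: cofreeP => j; rewrite cofreeD !fE -linearD -cofreeD.
- move: a; apply: (homog_ind (galg_grading L)) => [|a b ha hb|i a ai].
  + by rewrite !scale0r; apply: cofreeP => j; rewrite fE linear0.
  + rewrite !scalerDl -ha -hb; apply: cofreeP => j.
    by rewrite cofreeD !fE -linearD -cofreeD.
  apply: cofreeP => j; rewrite fE [in RHS](cofree_scale_homog _ _ ai) fE -linearZ.
  by congr (e _); exact: cofree_scale_homog.
have [j u /cofree_pieceP uj|g gE] := @grHom_exists _ _ _ _ f'.
  by apply/cofree_pieceP => i ij; rewrite f'E fE uj // linear0.
by exists g => u j; rewrite gE f'E.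
Qed.

(** The transpose of [f] under the adjunction. Its values have finite support because an element of
    [P] has finitely many nonzero components. *)
Lemma cofree_unit_exists (P : grModule L) (N : lmodType L) (f : modHom P N) :
  exists g : grHom P (cofree_grModule N),
    forall x j, cofree_val (g x) j = f (component (gmod_grading P) j x).
Proof.
have ex (x : P) :
    exists v : cofree N, forall j, v j = f (component (gmod_grading P) j x).
  have [s xs] := component_finite (gmod_grading P) x.
  apply: (@cofree_exists _ _ s) => j /xs ->.
  exact: linear0.
have [g gE] := choice ex.
have [x y|a x|g' g'E] := @modHom_exists _ _ P (cofree_grModule N) g.
- by apply: cofreeP => j; rewrite cofreeD !gE -linearD componentD.
- move: a; apply: (homog_ind (galg_grading L)) => [|a b ha hb|i a ai].
  + by rewrite !scale0r; apply: cofreeP => j; rewrite gE component0 linear0.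
  + rewrite !scalerDl -ha -hb; apply: cofreeP => j.
    by rewrite cofreeD !gE -linearD componentD.
  apply: cofreeP => j; rewrite gE [in RHS](cofree_scale_homog _ _ ai) gE -linearZ.
  by rewrite -{1}[j](subrKC i%:Z) component_scale.
have [j x xj|h hE] := @grHom_exists _ _ _ _ g'.
  apply/cofree_pieceP => i ij.
  by rewrite g'E gE (component_homog _ _ xj) (negPf ij) linear0.
by exists h => x j; rewrite hE g'E gE.
Qed.

(** The cofree construction preserves surjections. Hence the transpose of [f] lifts through the
    cofree map of [e], and composing this lift with the counit gives the ungraded lift. *)
Lemma gr_projective_projective (P : grModule L) :
  gr_projective P -> projective (P : lmodType L).
Proof.
move=> projP M N e f esurj.
have [Ge GeE] := cofree_map_exists e; have [Gf GfE] := cofree_unit_exists f.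
have [v|g gE] := projP _ _ Ge Gf.
  (* Zero entries must receive the preimage zero, so that the chosen family again has finite
     support. *)
  have ex j : exists y, e y = cofree_val v j /\ (cofree_val v j = 0 -> y = 0).
    have [->|vj] := eqVneq (cofree_val v j) 0; first by exists 0; rewrite linear0.
    have [y yE] := esurj (cofree_val v j).
    by exists y; split=> // /eqP; rewrite (negPf vj).
  have [w wE] := choice ex; have [s vs] := cofree_finite v.
  have [|u uE] := @cofree_exists _ w s; first by move=> j /vs vj; apply: (wE j).2.
  by exists u; apply: cofreeP => j; rewrite GeE uE (wE j).1.
have [c cE] := cofree_counit_exists M.
have [x y|a x|h hE] := @modHom_exists _ _ P M (fun x => c (g x)).
- by rewrite !linearD.
- by rewrite !linearZ.
exists h; apply: (homog_ind (gmod_grading P)) => [|x y hx hy|j x xj].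
- by rewrite !linear0.
- by rewrite !linearD hx hy.
rewrite hE (cE j (g x)); last exact: (grHom_piece g xj).
transitivity (cofree_val (Ge (g x)) j); first by rewrite GeE.
by rewrite gE GfE (component_id _ xj).
Qed.

End Cofree.

(** * Comparison of projective resolutions *)

Section Image.
Variables (k : fieldType) (L : algType k) (M N : lmodType L) (e : modHom M N).

Definition in_image : {pred N} := fun y => `[< exists x, e x = y >].

Fact in_image_submod : submod_closed in_image.
Proof.
split=> [|a y y' /asboolP[x <-] /asboolP[x' <-]]; apply/asboolP.
  by exists 0; exact: linear0.
by exists (a *: x + x'); rewrite linearP.
Qed.
HB.instance Definition _ :=
  GRing.isSubmodClosed.Build L N in_image in_image_submod.

Record image_module := ImageModule {
  image_val :> N;
  image_valP : image_val \in in_image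
}.
HB.instance Definition _ := [isSub for image_val].
HB.instance Definition _ := [Choice of image_module by <:].
HB.instance Definition _ := [SubChoice_isSubLmodule of image_module by <:].

(** Projectivity speaks of surjections only, so [e] and [f] are both corestricted to the image of
    [e]. *)
Lemma projective_lift (P : lmodType L) (f : modHom P N) :
  projective P -> (forall x, exists y, e y = f x) ->
  exists g : modHom P M, forall x, e (g x) = f x.
Proof.
move=> projP ef.
have eP x : e x \in in_image by apply/asboolP; exists x.
have fP x : f x \in in_image by exact/asboolP.
have [x y|a x|e' e'E] :=
  @modHom_exists _ _ M image_module (fun x => ImageModule (eP x)).
- by apply/val_inj; rewrite /= linearD.
- by apply/val_inj; rewrite /= linearZ.
have [x y|a x|f' f'E] :=
  @modHom_exists _ _ P image_module (fun x => ImageModule (fP x)).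
- by apply/val_inj; rewrite /= linearD.
- by apply/val_inj; rewrite /= linearZ.
have [y|g gE] := projP _ _ e' f'.
  case: y => y yP; have /asboolP[x xE] := yP.
  by exists x; apply/val_inj; rewrite e'E.
by exists g => x; have := congr1 image_val (gE x); rewrite e'E f'E.
Qed.

End Image.

(** Lifts and homotopies are built degree by degree, each map depending on the previous one; [inv]
    expresses that the next equation is solvable. *)
Lemma dependent_choice_nat (A : nat -> Type) (inv : forall n, A n -> Prop)
    (next : forall n, A n -> A n.+1 -> Prop) (a0 : A 0%N) :
  inv 0%N a0 ->
  (forall n a, inv n a -> exists b, inv n.+1 b /\ next n a b) ->
  exists F : forall n, A n, F 0%N = a0 /\ forall n, next n (F n) (F n.+1).
Proof.
move=> inv0 step.
pose st n (a : {a | inv n a}) := cid (step n (projT1 a) (projT2 a)).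
pose G := fix G n : {a | inv n a} := match n with
  | 0 => exist _ a0 inv0
  | n'.+1 => exist _ (projT1 (st n' (G n'))) (proj1 (projT2 (st n' (G n'))))
  end.
exists (fun n => projT1 (G n)); split=> // n.
exact: (proj2 (projT2 (st n (G n)))).
Qed.

Section NullCochain.
Variables (k : fieldType) (L : algType k).
Variables (X : nat -> lmodType L) (dX : forall n, modHom (X n.+1) (X n)).

(** The coboundary condition for an arbitrary sequence of maps, so that it also applies to the tail
    of a resolution, reindexed to start at zero. *)
Definition null_cochain (N : lmodType L) (n : nat) : modHom (X n) N -> Prop :=
  match n with
  | 0 => fun f => forall x, f x = 0
  | m.+1 => fun f => exists y : modHom (X m) N, forall x, f x = y (dX m x)
  end.

Lemma null_cochain_ext N n (f g : modHom (X n) N) :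
  (forall x, f x = g x) -> null_cochain f -> null_cochain g.
Proof. by move=> /modHomP ->. Qed.

Lemma null_cochainD N n (f g : modHom (X n) N) :
  null_cochain f -> null_cochain g -> null_cochain (f + g).
Proof.
case: n f g => [|n] f g; first by move=> f0 g0 x; rewrite /= f0 g0 addr0.
by move=> [y fE] [z gE]; exists (y + z) => x /=; rewrite fE gE.
Qed.

End NullCochain.

Lemma null_cochain_precomp (k : fieldType) (L : algType k)
    (X Y : nat -> lmodType L) (dX : forall n, modHom (X n.+1) (X n))
    (dY : forall n, modHom (Y n.+1) (Y n)) (N : lmodType L) n
    (g : modHom (Y n) N) (F : forall n, modHom (X n) (Y n)) :
  (forall n x, dY n (F n.+1 x) = F n (dX n x)) ->
  null_cochain dY g -> null_cochain dX (precomp (F n) g).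
Proof.
move=> dF; case: n g => [|n] g; first by move=> g0 x; exact: g0.
by move=> [z gE]; exists (precomp (F n) z) => x /=; rewrite gE dF.
Qed.

(** * The comparison theorem for complexes of projectives *)

Section Comparison.
Variables (k : fieldType) (L : algType k).
Variables (X : nat -> lmodType L) (dX : forall n, modHom (X n.+1) (X n)).
Hypothesis projX : forall n, projective (X n).
Hypothesis ddX : forall n x, dX n (dX n.+1 x) = 0.
Variables (T : lmodType L) (R : resolution T).

(** With [X] the tail of a resolution this lifts cocycles; with [X] a whole resolution it yields
    comparison maps. *)
Lemma lift_exists (f : modHom (X 0%N) T) : (forall x, f (dX 0%N x) = 0) ->
  exists F : forall n, modHom (X n) (R n),
    (forall x, res_aug R (F 0%N x) = f x) /\
    (forall n x, res_d R n (F n.+1 x) = F n (dX n x)).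
Proof.
move=> fd.
have [F0 F0E] : exists F0 : modHom (X 0%N) (R 0%N),
    forall x, res_aug R (F0 x) = f x.
  by apply: projective_lift => // x; exact: res_surj.
have [|n a inva|F [F0' dF]] := @dependent_choice_nat
  (fun n => modHom (X n) (R n))
  (fun n a => forall x, exists y, res_d R n y = a (dX n x))
  (fun n a b => forall x, res_d R n (b x) = a (dX n x)) F0.
- by move=> x; apply/res_exact0; rewrite F0E.
- have [//|b bE] := @projective_lift _ _ _ _ (res_d R n) _ (precomp (dX n) a)
    (@projX n.+1).
  exists b; split=> // x; apply/res_exact; rewrite bE /=.
  by rewrite ddX linear0.
by exists F; rewrite F0'.
Qed.

(* When [X] is a truncation of a larger complex, [e] may factor through the
   differential out of [X 0]; this covers lifts of coboundaries. *)
Lemma homotopy_exists (F : forall n, modHom (X n) (R n))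
    (e : modHom (X 0%N) (R 0%N)) :
  (forall n x, res_d R n (F n.+1 x) = F n (dX n x)) ->
  (forall x, res_aug R (F 0%N x) = res_aug R (e x)) ->
  (forall x, e (dX 0%N x) = 0) ->
  exists t : forall n, modHom (X n) (R n.+1),
    (forall x, F 0%N x = e x + res_d R 0%N (t 0%N x)) /\
    (forall n x, F n.+1 x = t n (dX n x) + res_d R n.+1 (t n.+1 x)).
Proof.
move=> dF augF ed.
have [|t0 t0E] := @projective_lift _ _ _ _ (res_d R 0%N) _ (F 0%N - e) (@projX 0%N).
  by move=> x; apply/res_exact0; rewrite linearB augF subrr.
(* The invariant says that what remains of [F n.+1] after subtracting the previous homotopy map
   composed with [dX n] is a boundary in [R]. *)
have [|n a inva|t [t0' tE]] := @dependent_choice_nat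
  (fun n => modHom (X n) (R n.+1))
  (fun n a => forall x, exists y, res_d R n.+1 y = F n.+1 x - a (dX n x))
  (fun n a b => forall x, res_d R n.+1 (b x) = F n.+1 x - a (dX n x)) t0.
- move=> x; apply/res_exact; rewrite linearB dF t0E /= ed subr0 subrr //.
- have [//|b bE] := @projective_lift _ _ _ _ (res_d R n.+1) _
    (F n.+1 - precomp (dX n) a) (@projX n.+1).
  exists b; split=> // x; apply/res_exact; rewrite linearB bE /= dF ddX.
  by rewrite linear0 subr0 subrr.
by exists t; rewrite t0'; split=> [x|n x]; rewrite ?t0E ?tE addrC subrK.
Qed.

(** A lift of zero is null-homotopic, by [homotopy_exists] with [e = 0]. Composing with the cocycle
    [g] kills the term ending in [res_d], and what is left factors through [dX], or is zero in
    degree zero. *)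
Lemma null_cochain_lift (F : forall n, modHom (X n) (R n)) N n
    (g : modHom (R n) N) :
  (forall n x, res_d R n (F n.+1 x) = F n (dX n x)) ->
  (forall x, res_aug R (F 0%N x) = 0) -> (forall x, g (res_d R n x) = 0) ->
  null_cochain dX (precomp (F n) g).
Proof.
move=> dF augF gd.
have [||t [t0 tS]] := homotopy_exists (e := 0) dF => //.
  by move=> x; rewrite augF linear0.
case: n g gd => [|n] g gd.
  by move=> x; rewrite /= t0 linearD gd linear0 addr0.
by exists (precomp (t n) g) => x; rewrite /= tS linearD gd addr0.
Qed.

End Comparison.

(** * Isomorphisms *)

Lemma injective_surjective_bijective (A B : Type) (f : A -> B) :
  injective f -> (forall y, exists x, f x = y) -> bijective f.
Proof.
move=> f_inj /choice[g fK]; exists g => // x; exact/f_inj/fK.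
Qed.

Lemma galg_iso_sym (k : fieldType) (A B : galgData k) :
  galg_iso A B -> galg_iso B A.
Proof.
move=> [phi [phi_bij phi1 phiM]].
have inv i : exists psi : {linear B i -> A i},
    cancel (phi i) psi /\ cancel psi (phi i).
  have [g phiK gK] := phi_bij i.
  have lg : linear g by move=> a x y; rewrite -{1}[x]gK -{1}[y]gK -linearP phiK.
  pose psi : {linear B i -> A i} :=
    HB.pack g (GRing.isLinear.Build k (B i) (A i) *:%R g lg).
  by exists psi; split.
pose psi i := projT1 (cid (inv i)).
have phiK i : cancel (phi i) (psi i) by case: (projT2 (cid (inv i))).
have psiK i : cancel (psi i) (phi i) by case: (projT2 (cid (inv i))).
exists psi; split=> [i||i j x y].
- by exists (phi i); [exact: psiK | exact: phiK].
- by rewrite -phi1 phiK.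
- by rewrite -{1}[x]psiK -{1}[y]psiK -phiM phiK.
Qed.

Lemma galg_iso_trans (k : fieldType) (A B C : galgData k) :
  galg_iso A B -> galg_iso B C -> galg_iso A C.
Proof.
move=> [f [f_bij f1 fM]] [g [g_bij g1 gM]].
exists (fun i => (g i : {linear _ -> _}) \o (f i) : {linear A i -> C i}).
split=> [i||i j x y] /=; first exact: (bij_comp (g_bij i) (f_bij i)).
- by rewrite f1 g1.
- by rewrite fM gM.
Qed.

(** The maps [f i] form a family indexed by the degree, hence commute with the transport [ecast] in
    the opposite product. *)
Lemma galg_iso_op (k : fieldType) (A B : galgData k) :
  galg_iso A B -> galg_iso (galg_op A) (galg_op B).
Proof.
move=> [f [f_bij f1 fM]]; exists f; split=> // i j x y /=.
by rewrite -fM; case: _ / (addnC j i).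
Qed.

(** A criterion in a single degree: on cocycles [u] preserves cocycles, preserves and reflects
    coboundaries, and reaches every class. The last clause computes [phi] on any chosen
    representatives. *)
Lemma cohomology_iso (k : fieldType) (C D : cochain k) i
    (u : {linear C i -> D i}) :
  (forall z, codiff C i z = 0 -> codiff D i (u z) = 0) ->
  (forall z, codiff C i z = 0 -> is_coboundary (u z) <-> is_coboundary z) ->
  (forall w, codiff D i w = 0 ->
     exists2 z, codiff C i z = 0 & is_coboundary (w - u z)) ->
  exists phi : {linear cohomology C i -> cohomology D i},
    bijective phi /\
    forall (z : cocycle C i) (w : cocycle D i),
      u (cocycle_val z) = cocycle_val w -> phi (coclass z) = coclass w.
Proof.
move=> uZ uB usurj.
have uP (z : cocycle C i) : u (cocycle_val z) \in @is_cocycle _ D i.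
  exact/eqP/uZ/eqP/cocycle_valP.
pose v z := Cocycle (uP z).
have vD a z w : v (a *: z + w) = a *: v z + v w.
  by apply: val_inj; rewrite /= linearP.
have vP z w : coclass (v z) = coclass (v w) <-> coclass z = coclass w.
  split=> /coclassP => [h|h]; apply/coclassP; move: h; rewrite /= -linearB.
    by move=> h; apply/uB => //; apply/eqP/(cocycle_valP (z - w)).
  by move=> h; apply/uB => //; apply/eqP/(cocycle_valP (z - w)).
pose f (x : cohomology C i) : cohomology D i := coclass (v (repr x)).
have fE z : f (coclass z) = coclass (v z).
  by apply/vP; rewrite {1}/coclass reprK.
have lf : linear f.
  move=> a x y; have [z ->] := coclass_repr x; have [w ->] := coclass_repr y.
  rewrite !fE.
  have coclassP' (E : cochain k) (z' w' : cocycle E i) :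
      a *: coclass z' + coclass w' = coclass (a *: z' + w').
    by rewrite coclassD -coclassZ.
  by rewrite !coclassP' fE vD.
pose phi : {linear cohomology C i -> cohomology D i} :=
  HB.pack f (GRing.isLinear.Build k _ _ *:%R f lf).
exists phi; split=> [|z w zw]; last first.
  by rewrite /= fE; congr coclass; exact: val_inj.
apply: injective_surjective_bijective => [x y|y] /=.
  have [z ->] := coclass_repr x; have [w ->] := coclass_repr y.
  by rewrite !fE => /vP.
have [w ->] := coclass_repr y.
have [|z zZ wz] := usurj (cocycle_val w); first exact/eqP/cocycle_valP.
have zP : z \in @is_cocycle _ C i by exact/eqP.
exists (coclass (Cocycle zP)); rewrite fE; apply/esym/coclassP; exact: wz.
Qed.

(** * Independence of the Ext-algebra of the resolution *)

Section HomComplex.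
Variables (k : fieldType) (L : algType k) (T : lmodType L) (P : resolution T).

Lemma res_dd n x : res_d P n (res_d P n.+1 x) = 0.
Proof. by apply/res_exact; exists x. Qed.

Lemma res_aug_d x : res_aug P (res_d P 0%N x) = 0.
Proof. by apply/res_exact0; exists x. Qed.

Lemma codiff_HomP N i (f : modHom (P i) N) :
  codiff (Hom_complex P N) i f = 0 <-> forall x, f (res_d P i x) = 0.
Proof.
split=> [f0 x|f0]; last by apply: modHomP => x /=; exact: f0.
exact: (congr1 (fun h : modHom _ N => h x) f0).
Qed.

Lemma is_coboundary_HomP N i (f : modHom (P i) N) :
  is_coboundary (f : Hom_complex P N i) <-> null_cochain (res_d P) f.
Proof.
case: i f => [|i] f /=; first by split=> [->|f0] //; apply: modHomP.
split=> -[y yE]; exists y; first by move=> x; rewrite -yE.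
by apply: modHomP => x; rewrite yE.
Qed.

Lemma cocycle_homP N i (z : cocycle (Hom_complex P N) i) x :
  cocycle_hom z (res_d P i x) = 0.
Proof. exact: (proj1 (codiff_HomP _) (eqP (cocycle_valP z))). Qed.

Lemma cocycle_exists N i (f : modHom (P i) N) :
  (forall x, f (res_d P i x) = 0) ->
  exists z : cocycle (Hom_complex P N) i, cocycle_hom z = f.
Proof.
move=> f0; have fP : (f : Hom_complex P N i) \in @is_cocycle _ (Hom_complex P N) i.
  by apply/eqP/codiff_HomP.
by exists (Cocycle fP).
Qed.

Lemma coclass_HomP N i (z w : cocycle (Hom_complex P N) i) :
  coclass z = coclass w <-> null_cochain (res_d P) (cocycle_hom z - cocycle_hom w).
Proof. by rewrite coclassP; exact: is_coboundary_HomP. Qed.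

(** For positive [j] the two conditions agree by computation. For [j = 0] the tail has no earlier
    term, so its condition is that [f] vanishes, which is the stronger one. *)
Lemma null_cochain_shift N i j (f : modHom (P (j + i)%N) N) :
  null_cochain (X := fun n => P (n + i)%N) (n := j) (fun n => res_d P (n + i)) f ->
  null_cochain (res_d P) f.
Proof.
case: j f => [|j] f; last by [].
move=> f0; case: i f f0 => [|i] f f0 //=.
by exists 0.
Qed.

Lemma is_lift_exists i (f : cocycle (Hom_complex P T) i) :
  exists F, is_lift (cocycle_hom f) F.
Proof.
apply: (@lift_exists _ _ (fun n => P (n + i)%N) (fun n => res_d P (n + i))).
- by move=> n; exact: res_proj.
- by move=> n x; exact: res_dd.
- exact: cocycle_homP.
Qed.

(** A coboundary has a degree zero lift [e] factoring through the differential, and [F] is homotopic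
    to [e] in degree zero and to zero above. The cocycle [g] turns both the homotopy and [e] into
    coboundaries. *)
Lemma null_cochain_lift_null i j (F : forall n, modHom (P (n + i)%N) (P n))
    (f : modHom (P i) T) N (g : modHom (P j) N) :
  is_lift f F -> null_cochain (res_d P) f -> (forall x, g (res_d P j x) = 0) ->
  null_cochain (res_d P) (precomp (F j) g).
Proof.
move=> [augF dF] fnull g0.
have [e [augE ed eS]] : exists e : modHom (P i) (P 0%N),
    [/\ forall x, res_aug P (e x) = f x, forall x, e (res_d P i x) = 0
      & forall g0 : modHom (P 0%N) N, null_cochain (res_d P) (precomp e g0)].
  case: i f {F augF dF} fnull => [|i] f /=.
    move=> f0; exists 0; split=> [x||g' x] //=; first by rewrite f0 linear0.
    by rewrite linear0.
  (* Here [f] is [y] after the differential; lifting [y] through the augmentation to [s] gives [e]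
     as [s] after the differential. *)
  move=> [y yE].
  have [//|s sE] := @projective_lift _ _ _ _ (res_aug P) _ y (@res_proj _ _ _ P i).
    by move=> x; exact: res_surj.
  exists (precomp (res_d P i) s); split=> [x|x|g'] /=.
  - by rewrite sE yE.
  - by rewrite res_dd linear0.
  - by exists (precomp s g').
have [|||||t [t0 tS]] := @homotopy_exists _ _ (fun n => P (n + i)%N)
    (fun n => res_d P (n + i)) _ _ _ P F e => //.
- by move=> n; exact: res_proj.
- by move=> n x; exact: res_dd.
- by move=> x; rewrite augF augE.
case: j g g0 => [|j] g g0.
  apply: null_cochain_ext (eS g) => x /=.
  by rewrite t0 linearD g0 addr0.
exists (precomp (t j) g) => x /=.
by rewrite tS linearD g0 addr0.
Qed.

(** Independence of all choices, from [g F - g' F' = g (F - F') + (g - g') F']: in the first summand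
    [F - F'] lifts a coboundary, and the second is a coboundary pulled back along a chain map. *)
Lemma yonedaE i j (g : cocycle (Hom_complex P T) j)
    (f : cocycle (Hom_complex P T) i) F (h : cocycle (Hom_complex P T) (j + i)) :
  is_lift (cocycle_hom f) F ->
  (forall u, cocycle_hom h u = cocycle_hom g (F j u)) ->
  yoneda (coclass g) (coclass f) = coclass h.
Proof.
move=> fF hE; rewrite /yoneda; set S := (X in xget _ X).
(* The given data show that the set is inhabited, so [xget] returns a member and not just its
   default [0]. *)
have /(xgetPex 0) : exists z, S z by exists (coclass h), g, f, F, h.
move: (xget _ _) => z [g' [f' [F' [h' [gg' ff' [aug' d'] h'E ->]]]]].
case: fF => augF dF.
move/coclass_HomP: gg' => gg'; move/coclass_HomP: ff' => ff'.
apply/esym/coclass_HomP.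
have lift_diff : is_lift (cocycle_hom f - cocycle_hom f') (fun n => F n - F' n).
  split=> [x|n x]; first by rewrite linearB augF aug'.
  by rewrite linearB dF d'.
have := null_cochainD
  (null_cochain_lift_null lift_diff ff' (cocycle_homP g))
  (null_cochain_shift (null_cochain_precomp (X := fun n => P (n + i)%N) d' gg')).
apply: null_cochain_ext => x /=.
by rewrite hE h'E linearB addrA subrK.
Qed.

Lemma yoneda_exists i j (g : cocycle (Hom_complex P T) j)
    (f : cocycle (Hom_complex P T) i) :
  exists F h, [/\ is_lift (cocycle_hom f) F,
    forall u, cocycle_hom h u = cocycle_hom g (F j u)
    & yoneda (coclass g) (coclass f) = coclass h].
Proof.
have [F fF] := is_lift_exists f.
have [x|h hE] := @cocycle_exists T (j + i) (precomp (F j) (cocycle_hom g)).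
  by rewrite /= -(proj2 fF) cocycle_homP.
have hE' u : cocycle_hom h u = cocycle_hom g (F j u) by rewrite hE.
by exists F, h; split=> //; exact: yonedaE fF hE'.
Qed.

End HomComplex.

(** * Comparison maps between two resolutions of one module *)

Section ChangeOfResolution.
Variables (k : fieldType) (L : algType k) (T : lmodType L).

Definition is_comparison (P R : resolution T) (a : forall n, modHom (P n) (R n)) :=
  (forall x, res_aug R (a 0%N x) = res_aug P x) /\
  (forall n x, res_d R n (a n.+1 x) = a n (res_d P n x)).

Lemma comparison_exists (P R : resolution T) :
  exists a : forall n, modHom (P n) (R n), is_comparison a.
Proof.
apply: lift_exists; [exact: res_proj | exact: res_dd | exact: res_aug_d].
Qed.

(** The identity minus the round trip through [R] lifts zero, so [null_cochain_lift] applies. *)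
Lemma comparison_null (P R : resolution T) (a : forall n, modHom (P n) (R n))
    (b : forall n, modHom (R n) (P n)) N i (g : modHom (P i) N) :
  is_comparison a -> is_comparison b -> (forall x, g (res_d P i x) = 0) ->
  null_cochain (res_d P) (g - precomp (precomp (a i) (b i)) g).
Proof.
move=> [auga da] [augb db] g0.
pose idP n : modHom (P n) (P n) := (idfun : {linear P n -> P n}).
pose F n := idP n - precomp (a n) (b n).
have dF n x : res_d P n (F n.+1 x) = F n (res_d P n x).
  by rewrite linearB /= db da.
have augF x : res_aug P (F 0%N x) = 0 by rewrite linearB /= augb auga subrr.
have := null_cochain_lift (@res_proj _ _ _ P) (@res_dd _ _ _ P) dF augF g0.
apply: null_cochain_ext => x /=.
by rewrite linearB.
Qed.

Lemma ExtAlg_iso_resolution (P R : resolution T) :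
  galg_iso (ExtAlg P) (ExtAlg R).
Proof.
have [a aP] := comparison_exists P R; have [b bP] := comparison_exists R P.
have b_null N i (g : modHom (P i) N) :
    null_cochain (res_d P) g -> null_cochain (res_d R) (precomp (b i) g).
  exact: null_cochain_precomp (proj2 bP).
have a_null N i (g : modHom (R i) N) :
    null_cochain (res_d R) g -> null_cochain (res_d P) (precomp (a i) g).
  exact: null_cochain_precomp (proj2 aP).
have iso i : exists phi : {linear Ext P T i -> Ext R T i}, bijective phi /\
    forall (z : cocycle (Hom_complex P T) i) (w : cocycle (Hom_complex R T) i),
      (forall x, cocycle_hom w x = cocycle_hom z (b i x)) ->
      phi (coclass z) = coclass w.
  have [z z0|z z0|w w0|phi [phi_bij phiE]] :=
    @cohomology_iso _ (Hom_complex P T) (Hom_complex R T) i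
      (@precomp _ _ _ _ T (b i)).
  - apply/codiff_HomP => x; rewrite /= -(proj2 bP).
    exact: (proj1 (codiff_HomP _) z0).
  - split=> /is_coboundary_HomP z_null; apply/is_coboundary_HomP;
      last exact: b_null.
    have := null_cochainD
      (comparison_null aP bP (proj1 (codiff_HomP _) z0)) (a_null _ _ _ z_null).
    by apply: null_cochain_ext => x /=; rewrite subrK.
  - exists (precomp (a i) w); last first.
      apply/is_coboundary_HomP.
      have := comparison_null bP aP (proj1 (codiff_HomP _) w0).
      exact: null_cochain_ext.
    apply/codiff_HomP => x; rewrite /= -(proj2 aP).
    exact: (proj1 (codiff_HomP _) w0).
  exists phi; split=> // z w zw; apply: phiE; apply: modHomP => x.
  exact: esym (zw x).
pose phi i := projT1 (cid (iso i)).
have phi_bij i : bijective (phi i) by case: (projT2 (cid (iso i))).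
have phiE i := proj2 (projT2 (cid (iso i))).
have pull i (z : cocycle (Hom_complex P T) i) :
    exists w : cocycle (Hom_complex R T) i,
      forall x, cocycle_hom w x = cocycle_hom z (b i x).
  have [x|w wE] := @cocycle_exists _ _ _ R T i (precomp (b i) (cocycle_hom z)).
    by rewrite /= -(proj2 bP) cocycle_homP.
  by exists w => x; rewrite wE.
exists phi; split=> // [|i j x y].
  by apply: phiE => x; exact: esym (proj1 bP x).
have [g ->] := coclass_repr x; have [f ->] := coclass_repr y.
have [F [h [fF hE /= ->]]] := yoneda_exists g f.
have [g' g'E] := pull _ g; have [f' f'E] := pull _ f; have [h' h'E] := pull _ h.
rewrite (phiE _ _ _ g'E) (phiE _ _ _ f'E) (phiE _ _ _ h'E).
(* Conjugating the lift over [P] by the comparison maps gives a lift over [R], namely [a F b]. *)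
pose F' n : modHom (R (n + j)%N) (R n) :=
  precomp (b (n + j)%N) (precomp (F n) (a n)).
have f'F' : is_lift (cocycle_hom f') F'.
  split=> [z|n z] /=.
    by rewrite (proj1 aP) (proj1 fF) f'E.
  by rewrite (proj2 aP) (proj2 fF) (proj2 bP).
have [h2 h2E] : exists h2 : cocycle (Hom_complex R T) (i + j),
    forall u, cocycle_hom h2 u = cocycle_hom g' (F' i u).
  have [u|h2 h2E] := @cocycle_exists _ _ _ R T (i + j)
    (precomp (F' i) (cocycle_hom g')).
    transitivity (cocycle_hom g' (res_d R i (F' i.+1 u))).
      by rewrite (proj2 f'F').
    exact: cocycle_homP.
  by exists h2 => u; rewrite h2E.
rewrite (yonedaE f'F' h2E); apply/coclass_HomP.
(* The two representatives are [g F b] and [g b a F b]; they differ by [g - g b a], null by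
   [comparison_null], pulled back along the chain map [F b]. *)
pose bF n : modHom (R (n + j)%N) (P n) := precomp (b (n + j)%N) (F n).
have dbF n u : res_d P n (bF n.+1 u) = bF n (res_d R (n + j) u).
  by rewrite /= (proj2 fF) (proj2 bP).
have := null_cochain_shift (null_cochain_precomp (X := fun n => R (n + j)%N) dbF
  (comparison_null aP bP (cocycle_homP g))).
by apply: null_cochain_ext => u /=; rewrite h'E h2E hE g'E.
Qed.

End ChangeOfResolution.

(** * Comparison of graded and ungraded Ext *)

Section Forget.
Variables (k : fieldType) (L : grAlgebra k).

(** A shift keeps the underlying module, so this only retypes the map; the name lets it carry a
    [k]-linear structure. *)
Definition forget (M T : grModule L) (j : int) (f : grHom M (gshift T j)) :
  modHom M T := grHom_val f.

Fact forget_linear M T j : linear (@forget M T j).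
Proof. by move=> a f g; apply: modHomP. Qed.
HB.instance Definition _ M T j :=
  GRing.isLinear.Build k (grHom M (gshift T j)) (modHom M T)
    _ (@forget M T j) (@forget_linear M T j).

Lemma homog_component_degree (M T : grModule L) i (f : modHom M T)
    (g : grHom M (gshift T i)) : (forall x, f x = g x) ->
  forall x, homog_component f i x = g x.
Proof.
move=> fg x; suff : grHom_val (homog_component f i) = grHom_val g.
  exact: (congr1 (fun h : modHom M (gshift T i) => h x)).
apply: modHom_on_homog => j y yj; rewrite [LHS](homog_componentE f i yj) fg.
apply: component_id; exact: (grHom_piece g yj).
Qed.

(** Degree zero maps commute with taking components, here on the source and in the next lemma on the
    target. Equations for ungraded lifts and coboundaries thereby pass to components of a fixed
    degree. *)
Lemma homog_component_precomp (M M' N : grModule L) (d : grHom M' M)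
    (f : modHom M N) t x :
  homog_component (precomp d f) t x = homog_component f t (d x).
Proof.
suff : grHom_val (homog_component (precomp d f) t)
    = precomp (grHom_val d) (grHom_val (homog_component f t)).
  exact: (congr1 (fun h : modHom M' (gshift N t) => h x)).
apply: modHom_on_homog => j y yj; rewrite [LHS](homog_componentE _ t yj).
by rewrite [RHS](homog_componentE f t (grHom_piece d yj)).
Qed.

Lemma homog_component_postcomp (M N N' : grModule L) (d : grHom N N')
    (f : modHom M N) t x :
  homog_component (precomp f d) t x = d (homog_component f t x) :> N'.
Proof.
suff : (grHom_val (homog_component (precomp f d) t) : modHom M N')
    = precomp (grHom_val (homog_component f t) : modHom M N) (grHom_val d).
  exact: (congr1 (fun h : modHom M N' => h x)).
apply: modHom_on_homog => j y yj; rewrite [LHS](homog_componentE _ t yj).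
by rewrite [RHS](congr1 d (homog_componentE f t yj)) component_grHom.
Qed.

End Forget.

Section GradedExt.
Variables (k : fieldType) (L : grAlgebra k) (T : grModule L).
Variable Q : gr_resolution T.

Definition ungraded_resolution : resolution (T : lmodType L) :=
  @Resolution _ _ _ (fun n => Q n : lmodType L)
    (fun n => grHom_val (gres_d Q n)) (grHom_val (gres_aug Q))
    (fun n => gr_projective_projective (@gres_proj _ _ _ Q n))
    (@gres_surj _ _ _ Q) (@gres_exact0 _ _ _ Q) (@gres_exact _ _ _ Q).
Local Notation P := ungraded_resolution.

Lemma codiff_grHomP N i (f : grHom (Q i) N) :
  codiff (grHom_complex Q N) i f = 0 <-> forall x, f (gres_d Q i x) = 0.
Proof.
split=> [f0 x|f0]; last by apply/val_inj/modHomP => x /=; exact: f0.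
exact: (congr1 (fun h : grHom _ N => h x) f0).
Qed.

Lemma gr_cocycle_homP N i (z : cocycle (grHom_complex Q N) i) x :
  gr_cocycle_hom z (gres_d Q i x) = 0.
Proof. exact: (proj1 (codiff_grHomP _) (eqP (cocycle_valP z))). Qed.

Lemma gr_cocycle_exists N i (f : grHom (Q i) N) :
  (forall x, f (gres_d Q i x) = 0) ->
  exists z : cocycle (grHom_complex Q N) i, gr_cocycle_hom z = f.
Proof.
move=> f0.
have fP : (f : grHom_complex Q N i) \in @is_cocycle _ (grHom_complex Q N) i.
  by apply/eqP/codiff_grHomP.
by exists (Cocycle fP).
Qed.

Lemma is_coboundary_forget i (f : grHom (Q i) (gshift T i%:Z)) :
  is_coboundary (forget f : Hom_complex P T i) <->
  is_coboundary (f : grHom_complex Q (gshift T i%:Z) i).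
Proof.
rewrite is_coboundary_HomP.
(* The internal shift is generalized first, so that the case analysis affects the cohomological
   degree only. *)
move: (i%:Z) f => t; case: i => [|i] f /=.
  split=> [f0|-> //]; exact/val_inj/modHomP.
split=> [[y fE]|[y <-]]; last by exists (forget y).
exists (homog_component y t); apply/val_inj/modHomP => x /=.
rewrite -(homog_component_precomp (gres_d Q i)).
apply: homog_component_degree => u; exact: esym (fE u).
Qed.

(** A graded lift is obtained from an ungraded one by taking components of degree [i]. *)
Lemma gr_yoneda_exists i j (g : cocycle (grHom_complex Q (gshift T j%:Z)) j)
    (f : cocycle (grHom_complex Q (gshift T i%:Z)) i) :
  exists F (h : cocycle (grHom_complex Q (gshift T (j + i)%N%:Z)) (j + i)),
    is_gr_lift (gr_cocycle_hom f) F /\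
    forall u, gr_cocycle_hom h u = gr_cocycle_hom g (F j u) :> T.
Proof.
have [f' f'E] :=
  @cocycle_exists _ _ _ P T i (forget (gr_cocycle_hom f)) (gr_cocycle_homP f).
have [F [augF dF]] := is_lift_exists f'.
pose F' n : grHom (Q (n + i)%N) (gshift (Q n) i%:Z) := homog_component (F n) i%:Z.
have F'_lift : is_gr_lift (gr_cocycle_hom f) F'.
  split=> [x|n x].
    rewrite -(homog_component_postcomp (gres_aug Q)).
    by apply: homog_component_degree => u; rewrite [LHS]augF f'E.
  rewrite -(homog_component_postcomp (gres_d Q n)).
  rewrite -(homog_component_precomp (gres_d Q (n + i))).
  suff -> : precomp (F n.+1) (gres_d Q n) = precomp (gres_d Q (n + i)) (F n) by [].
  apply: modHomP => u; exact: dF.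
have [l x xl|h hE] := @grHom_exists _ _ (Q (j + i)%N) (gshift T (j + i)%N%:Z)
    (precomp (forget (F' j)) (forget (gr_cocycle_hom g))).
  have := grHom_piece (gr_cocycle_hom g) (grHom_piece (F' j) xl).
  by rewrite /gmod_piece /= /shift_piece PoszD opprD addrA addrAC.
have [x|h' h'E] := @gr_cocycle_exists _ _ h.
  rewrite hE.
  transitivity (gr_cocycle_hom g (gres_d Q j (F' j.+1 x))).
    exact: (congr1 (gr_cocycle_hom g) (esym (proj2 F'_lift j x))).
  exact: (gr_cocycle_homP g (F' j.+1 x)).
by exists F', h'; split=> // u; rewrite h'E hE.
Qed.

(** * Consequences of self-orthogonality *)

Hypothesis T_deg0 : concentrated_in_degree0 T.
Hypothesis T_ext : forall i (j : int), i%:Z != j ->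
  forall x : grExt Q (gshift T j) i, x = 0.

Lemma component_degree0 (y : T) : component (gmod_grading T) 0 y = y.
Proof.
move: y; apply: (homog_ind (gmod_grading T)) => [|x y hx hy|j x xj].
- exact: component0.
- by rewrite componentD hx hy.
rewrite (component_homog _ _ xj); case: eqVneq => // j0.
by rewrite (T_deg0 _ xj) // eq_sym.
Qed.

(** Every component of [w] is a graded cocycle, and those of degree other than [i] are coboundaries
    by self-orthogonality. Their primitives glue to one ungraded primitive, since [T] lies in degree
    zero. *)
Lemma cocycle_homog i (w : modHom (P i) T) : (forall x, w (res_d P i x) = 0) ->
  null_cochain (res_d P)
    (w - forget (homog_component (M := Q i) (N := T) w i%:Z)).
Proof.
move=> wd; pose f t := homog_component (M := Q i) (N := T) w t.
(* As [T] sits in degree zero, [f t] is just [w] on the piece of degree [t] and zero on the other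
   pieces. *)
have f_homog t j (x : Q i) : gmod_piece j x -> f t x = if j == t then w x else 0.
  move=> xj; rewrite (homog_componentE w t xj).
  have [->|jt] := eqVneq j t.
    by rewrite subrr component_degree0.
  apply: T_deg0 (component_piece _ _ _); by rewrite subr_eq0.
have f_cocycle t x : f t (gres_d Q i x) = 0.
  rewrite -(homog_component_precomp (gres_d Q i)).
  have -> : precomp (gres_d Q i) w = 0 by apply: modHomP => u; exact: wd.
  move: x; apply: (homog_ind (gmod_grading (Q i.+1))) => [|x y fx fy|j x xj].
  - exact: linear0.
  - by rewrite linearD fx fy addr0.
  by rewrite (homog_componentE _ t xj) component0.
have f_null t : i%:Z != t -> is_coboundary (f t : grHom_complex Q (gshift T t) i).
  move=> it; have [z zE] := gr_cocycle_exists (f_cocycle t).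
  have /coclassP := etrans (T_ext it (coclass z)) (esym (T_ext it (coclass 0))).
  by rewrite /= subr0 -[cocycle_val z]/(gr_cocycle_hom z) zE.
rewrite -[homog_component _ _]/(f i%:Z).
case: i w wd f f_homog f_cocycle f_null => [|i] w wd f f_homog f_cocycle f_null.
  (* In cohomological degree zero a coboundary is zero, so all components but [f 0] vanish. *)
  suff wE : w = forget (f 0).
    move=> x; have wx := congr1 (fun u : modHom (Q 0%N) T => u x) wE.
    transitivity (w x - forget (f 0) x); first by [].
    by rewrite -wx subrr.
  apply: modHom_on_homog => j x xj; rewrite [RHS](f_homog _ _ _ xj).
  have [//|j0] := eqVneq j 0.
  have fj0 : f j = 0 by apply: f_null; rewrite eq_sym.
  by rewrite -[LHS]/(if true then w x else 0) -(eqxx j) -(f_homog _ _ _ xj) fj0.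
have ex t : exists y : grHom (Q i) (gshift T t),
    i.+1%:Z != t -> forall x, f t x = y (gres_d Q i x).
  have [<-|it] := eqVneq i.+1%:Z t; first by exists 0.
  by have [y yE] := f_null t it; exists y => _ x; rewrite -yE.
have [y yE] : exists y : forall t, grHom (Q i) (gshift T t),
    forall t, i.+1%:Z != t -> forall x, f t x = y t (gres_d Q i x).
  by exists (fun t => projT1 (cid (ex t))) => t; exact: (projT2 (cid (ex t))).
(* The component of degree [i.+1] is the one subtracted from [w], so its slot in the glued family is
   set to zero. *)
have [z zE] :=
  @glue_grHoms _ _ _ _ (fun t => if i.+1%:Z == t then 0 else y t) T_deg0.
exists z.
suff E : w - forget (f i.+1%:Z) = precomp (grHom_val (gres_d Q i)) z.
  by move=> x; exact: (congr1 (fun h : modHom (Q i.+1) T => h x) E).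
apply: modHom_on_homog => j x xj; rewrite [RHS](zE j); last first.
  exact: (grHom_piece (gres_d Q i) xj).
transitivity (w x - f i.+1%:Z x) => //; rewrite (f_homog _ _ _ xj) eq_sym.
have [<-|ij] := eqVneq i.+1%:Z j; first by rewrite subrr.
by rewrite subr0 -yE // (f_homog _ _ _ xj) eqxx.
Qed.

(** On representatives the map is [forget]: [is_coboundary_forget] gives injectivity and
    [cocycle_homog] gives surjectivity. *)
Lemma grExtAlg_iso_ungraded : galg_iso (grExtAlg Q) (ExtAlg P).
Proof.
have iso i : exists phi : {linear grExt Q (gshift T i%:Z) i -> Ext P T i},
    bijective phi /\
    forall (z : cocycle (grHom_complex Q (gshift T i%:Z)) i)
           (w : cocycle (Hom_complex P T) i),
      (forall x, cocycle_hom w x = gr_cocycle_hom z x) ->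
      phi (coclass z) = coclass w.
  have [z /codiff_grHomP z0|z _|w /codiff_HomP w0|phi [phi_bij phiE]] :=
    @cohomology_iso _ (grHom_complex Q (gshift T i%:Z)) (Hom_complex P T) i
      (@forget _ _ _ T i%:Z).
  - by apply/codiff_HomP => x; exact: z0.
  - exact: is_coboundary_forget.
  - exists (homog_component (M := Q i) (N := T) w i%:Z).
      apply/codiff_grHomP => x; rewrite -(homog_component_precomp (gres_d Q i)).
      have -> : precomp (gres_d Q i) w = 0 by apply: modHomP => u; exact: w0.
      by apply: (homog_component_degree (g := 0)).
    by apply/is_coboundary_HomP; exact: cocycle_homog.
  exists phi; split=> // z w zw; apply: phiE; apply: modHomP => x.
  exact: esym (zw x).
pose phi i := projT1 (cid (iso i)).
have phi_bij i : bijective (phi i) by case: (projT2 (cid (iso i))).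
have phiE i := proj2 (projT2 (cid (iso i))).
have push i (z : cocycle (grHom_complex Q (gshift T i%:Z)) i) :
    exists w : cocycle (Hom_complex P T) i,
      forall x, cocycle_hom w x = gr_cocycle_hom z x.
  have [w wE] :=
    @cocycle_exists _ _ _ P T i (forget (gr_cocycle_hom z)) (gr_cocycle_homP z).
  by exists w => x; exact: (congr1 (fun h : modHom (Q i) T => h x) wE).
exists phi; split=> // [|i j x y]; first by apply: phiE.
rewrite [gmul x y]/(gr_yoneda x y) /gr_yoneda; set S := (X in xget _ X).
have /(xgetPex 0) : exists z, S z.
  have [g xE] := coclass_repr x; have [f yE] := coclass_repr y.
  have [F [h [fF hE]]] := gr_yoneda_exists g f.
  by exists (coclass h), g, f, F, h.
(* Uniqueness of the graded product is not established beforehand: whichever member [xget] picked,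
   forgetting its grading yields data to which [yonedaE] applies. *)
move: (xget _ _) => z [g [f [F [h [-> -> [augF dF] hE ->]]]]].
have [g' g'E] := push _ g; have [f' f'E] := push _ f; have [h' h'E] := push _ h.
rewrite (phiE _ _ _ g'E) (phiE _ _ _ f'E) (phiE _ _ _ h'E).
apply/esym/(@yonedaE _ _ _ P j i g' f' (fun n => forget (F n))).
  by split=> [u|n u]; [exact: etrans (augF u) (esym (f'E u)) | exact: dF].
by move=> u; exact: etrans (h'E u) (etrans (hE u) (esym (g'E _))).
Qed.

End GradedExt.


Theorem corollary3p1p3 (k : fieldType) (L : grAlgebra k) (r : nat)
    (L_lf : locally_finite L) (r_gt0 : (0 < r)%N) (L_aug : augmented0 L r)
    (T : grModule L) (T_so : graded_self_orthogonal T)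
    (P : resolution (T : lmodType L)) (Q : gr_resolution T) :
  galg_iso (galg_op (ExtAlg P)) (galg_op (grExtAlg Q)).
Proof.
have [_ _ T_deg0 T_ext] := T_so; apply: galg_iso_op.
(* The resolutions [P] and [Q] are unrelated, so [P] is first exchanged for the one underlying
   [Q]. *)
apply: galg_iso_trans (ExtAlg_iso_resolution P (ungraded_resolution Q)) _.
apply: galg_iso_sym; apply: grExtAlg_iso_ungraded => // i j; exact: T_ext.
Qed.
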